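(* Let $m\ge 1$ and let $\mathcal P_m$ be any polar code of length $2^m$ whose generating monomial set is $$P_m=\{\mathbf 1,x_0,x_1,\dots,x_{m-1}\}\cup S(x_0,\dots,x_{m-1}),$$ where $S(x_0,\dots,x_{m-1})$ is a set of monomials of degree greater than $1$ in $x_0,\dots,x_{m-1}$. Let $n>m$ and let $\mathcal P_n$ be the corresponding polar code of length $2^n$ with generating monomial set $$P_n=\{\mathbf 1,x_0',x_1',\dots,x_{m-1}'\}\cup S(x_0',\dots,x_{m-1}'),$$ where $x_i'=(x_i\,|\,x_i\,|\cdots|\,x_i)\in\mathbb F_2^{2^n}$ is the concatenation of $2^{n-m}$ copies of $x_i\in\mathbb F_2^{2^m}$, and $S(x_0',\dots,x_{m-1}')$ consists of the same monomials with each $x_i$ replaced by $x_i'$. Then the full automorphism group $\mathrm{Aut}\,\mathcal P_n$ is isomorphic to $$(\mathrm S_{2^{n-m}})^{2^m}:G,\qquad\text{where } G\cong \mathrm{Aut}\,\mathcal P_m .$$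
   Context: Monomials and evaluation. A monomial in $x_0,\dots,x_{n-1}$ is a squarefree product $x_0^{v_0}\cdots x_{n-1}^{v_{n-1}}$, $v\in\mathbb F_2^n$, of degree the Hamming weight of $v$; the degree $0$ monomial is $\mathbf 1$. A monomial is identified with its evaluation vector in $\mathbb F_2^{2^n}$: $\mathbf 1$ is the all-ones vector, $x_i$ is the vector whose entry in position $j\in\{0,\dots,2^n-1\}$ is $1$ if and only if the $i$-th binary digit of $j$ ($i=0$ least significant) is $0$ (so $x_0=1010\cdots$, $x_1=11001100\cdots$, and $x_{n-1}$ is $2^{n-1}$ ones followed by $2^{n-1}$ zeros), and products of monomials are entrywise products. With this convention the concatenation $(x_i|x_i)$ of the length-$2^n$ vector $x_i$ with itself is the length-$2^{n+1}$ vector $x_i$. A monomial code of length $2^n$ is the $\mathbb F_2$-span of the evaluation vectors of a set $M$ of monomials, called its generating monomial set. It is decreasing if $g\in M$, $f$ a monomial and $f\preccurlyeq g$ imply $f\in M$, where for equal degrees $x_{i_1}\cdots x_{i_s}\preccurlyeq x_{j_1}\cdots x_{j_s}$ (indices in increasing order) iff $i_k\le j_k$ for all $k$, and in general $f\preccurlyeq g$ iff there is a divisor $g'$ of $g$ with $\deg g'=\deg f$ and $f\preccurlyeq g'$. Polar codes of length $N=2^n$ are the codes $\{uT_N: u\in\mathbb F_2^N,\ u_i=0 \text{ for } i\notin\mathcal I\}$, where $T_N=\begin{pmatrix}1&0\\1&1\end{pmatrix}^{\otimes n}$ and $\mathcal I\subseteq\{0,\dots,N-1\}$ is the information set. The rows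 of $T_N$ are evaluation vectors of monomials, so these are monomial codes; polar codes are always taken to be decreasing monomial codes. Automorphisms. $\mathrm S_N$ is the symmetric group of degree $N$; it acts on $\mathbb F_2^N$ by permuting coordinates. An automorphism of a code $\mathcal C\subseteq\mathbb F_2^N$ is a permutation $\tau\in\mathrm S_N$ with $\tau(c)\in\mathcal C$ for all $c\in\mathcal C$; $\mathrm{Aut}\,\mathcal C$ is the group of all automorphisms. The notation $A:B$ denotes a semidirect product (split extension) with normal subgroup $A$ and complement $B$. *)

(* Defs.v *)
From HB Require Import structures.
From mathcomp Require Import all_boot all_order all_algebra all_fingroup.
From mathcomp Require Import mxtens.

Set Implicit Arguments.
Unset Strict Implicit.
Unset Printing Implicit Defensive.

Import GRing.Theory.
Local Open Scope ring_scope.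

(* A squarefree monomial in x_0, ..., x_(n-1) is the set of the indices of its
   variables: set0 is the monomial 1, #|f| is the degree of f, and inclusion is
   divisibility. *)
Notation monomial n := {set 'I_n}.

(* The value at f of the vectors x_0, ..., x_(n-1) under entrywise product. *)
Definition monomial_eval (n N : nat) (x : 'I_n -> 'rV['F_2]_N)
    (f : monomial n) : 'rV['F_2]_N :=
  \row_j \prod_(i in f) x i 0 j.

Definition monomial_code (n N : nat) (x : 'I_n -> 'rV['F_2]_N)
    (M : {set monomial n}) : {vspace 'rV['F_2]_N} :=
  <<[seq monomial_eval x f | f <- enum M]>>%VS.

(* The entry of x_i in position j is 1 iff the i-th binary digit of j is 0. *)
Definition eval_var (n : nat) (i : 'I_n) : 'rV['F_2]_(2 ^ n) :=
  \row_(j < 2 ^ n) (~~ odd (j %/ 2 ^ i))%:R.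

(* [enum f] lists the indices of f in increasing order; [all2] also requires
   the two lists to have the same size. *)
Definition monomial_le_eqdeg (n : nat) (f g : monomial n) : bool :=
  all2 (fun i j : 'I_n => (i <= j)%N) (enum f) (enum g).

Definition monomial_le (n : nat) (f g : monomial n) : bool :=
  [exists g' : monomial n, (g' \subset g) && monomial_le_eqdeg f g'].

Definition decreasing (n : nat) (M : {set monomial n}) : Prop :=
  forall f g : monomial n, g \in M -> monomial_le f g -> f \in M.

Definition polar_kernel : 'M['F_2]_2 := \matrix_(i < 2, j < 2) (j <= i)%N%:R.

Definition polar_transform (n : nat) : 'M['F_2]_(2 ^ n) := polar_kernel ^t n.

(* The code of length 2 ^ n with information set I. *)
Definition polar_words (n : nat) (I : {set 'I_(2 ^ n)}) :
    {set 'rV['F_2]_(2 ^ n)} :=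
  [set u *m polar_transform n
     | u in [set u : 'rV['F_2]_(2 ^ n) | [forall (i | i \notin I), u 0 i == 0]]].

Definition polar_code (n : nat) (M : {set monomial n})
    (C : {vspace 'rV['F_2]_(2 ^ n)}) : Prop :=
  [/\ exists I : {set 'I_(2 ^ n)}, C =i polar_words I,
      C = monomial_code (@eval_var n) M
    & decreasing M].

(* The concatenation of 2 ^ (n - m) copies of c when m <= n. *)
Definition concat_copies (m n : nat) (c : 'rV['F_2]_(2 ^ m)) :
    'rV['F_2]_(2 ^ n) :=
  \row_(j < 2 ^ n) c 0 (Ordinal (ltn_pmod j (expn_gt0 2 m))).

(* The monomials of degree at most 1, together with those in S. *)
Definition generating_set (m : nat) (S : {set monomial m}) :
    {set monomial m} :=
  [set set0] :|: [set [set i] | i : 'I_m] :|: S.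

(* The entry of c in position j moves to position t j, which makes this a right
   action for the product of permutations. *)
Definition perm_word (N : nat) (t : 'S_N) (c : 'rV['F_2]_N) : 'rV['F_2]_N :=
  col_perm t^-1%g c.

Definition Aut_code (N : nat) (C : {vspace 'rV['F_2]_N}) : {set 'S_N} :=
  [set t : 'S_N | [forall (c : 'rV['F_2]_N | c \in C), perm_word t c \in C]].

Lemma Aut_code_group_set (N : nat) (C : {vspace 'rV['F_2]_N}) :
  group_set (Aut_code C).
Proof.
apply/group_setP; split=> [|s t].
  rewrite inE; apply/'forall_implyP => c cC.
  by rewrite /perm_word invg1 col_perm1.
rewrite !inE => /'forall_implyP sC /'forall_implyP tC.
apply/'forall_implyP => c cC.
by rewrite /perm_word invMg col_permM; apply/tC/sC.
Qed.

Canonical Aut_code_group (N : nat) (C : {vspace 'rV['F_2]_N}) :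
  {group 'S_N} := Group (Aut_code_group_set C).

(* For m <= n the x'_i are the first m variables of length 2 ^ n, so a monomial
   in the x'_i is the evaluation vector of the same monomial in n variables. *)
Lemma concat_copies_var (m n : nat) (lemn : (m <= n)%N) (i : 'I_m) :
  concat_copies n (eval_var i) = eval_var (widen_ord lemn i).
Proof.
apply/rowP => j; rewrite !mxE /=; congr (~~ _)%:R.
rewrite [in RHS](divn_eq j (2 ^ m)).
have -> : (2 ^ m = 2 ^ (m - i).-1 * 2 * 2 ^ i)%N.
  by rewrite -expnSr prednK ?subn_gt0 // -expnD subnK // ltnW.
by rewrite mulnA divnMDl ?expn_gt0 // mulnA oddD oddM andbF.
Qed.

(* Main.v *)
Require Import Defs.
From mathcomp Require Import all_boot all_order all_algebra all_fingroup.

(** Every coordinate of the short code [Pm] is repeated [2 ^ (n - m)] times in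
    [Pn]: the words of [Pn] are the [c \o p], for [c] in [Pm], where [p] is
    reduction of positions modulo [2 ^ m].  Permutations inside the fibres of
    [p] therefore fix every word of [Pn]; they form the normal factor, a product
    of [2 ^ m] symmetric groups of degree [2 ^ (n - m)].

    The variables [x_i] belong to [Pm] and read off the binary digits of a
    position, so the words of [Pm] separate positions.  Hence two positions of
    [Pn] lie in the same fibre of [p] exactly when all words of [Pn] agree on
    them ([fibre_separation]).  This description only mentions the code, so an
    automorphism of [Pn] permutes the fibres, and the permutation of the
    [2 ^ m] fibres that it induces is an automorphism of [Pm]
    ([induced_fibre_perm]).  Conversely quotient and remainder identify
    positions with pairs, so that an automorphism of [Pm] lifts to [Pn] by
    acting on remainders and fixing quotients; these lifts are the complement
    ([Aut_code_inflation]).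

    Monomials enter through two facts: they are evaluated entrywise, so that
    evaluation commutes with repetition ([monomial_code_colsub]), and the
    variables are among the generators and determine a position
    ([eval_var_separates]). *)

Set Implicit Arguments.
Unset Strict Implicit.
Unset Printing Implicit Defensive.

(** * Permutations of a product that respect the first projection *)

Section FibrePermutations.

Import GroupScope.

(** The groups of interest act on integers, hence a bijection [e] with pairs
    instead of permutations of [U * V] itself. *)
Variables (T U V : finType) (e : T -> U * V) (d : U * V -> T).
Hypotheses (eK : cancel e d) (dK : cancel d e).

Definition fibre_of (x : T) : U := (e x).1.

Definition base_act (s : {perm U}) (x : T) : T := d (s (e x).1, (e x).2).

Definition fibre_act (f : {dffun U -> {perm V}}) (x : T) : T :=
  d ((e x).1, f (e x).1 (e x).2).

Lemma base_act_inj s : injective (base_act s).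
Proof.
move=> x y /(can_inj dK) [/perm_inj exy1 exy2].
by apply: (can_inj eK); rewrite [e x]surjective_pairing exy1 exy2
  -surjective_pairing.
Qed.

Lemma fibre_act_inj f : injective (fibre_act f).
Proof.
move=> x y /(can_inj dK) [exy1]; rewrite exy1 => /perm_inj exy2.
by apply: (can_inj eK); rewrite [e x]surjective_pairing exy1 exy2
  -surjective_pairing.
Qed.

Definition base_perm s : {perm T} := perm (@base_act_inj s).
Definition fibre_perm f : {perm T} := perm (@fibre_act_inj f).

Lemma base_permM : {in setT &, {morph base_perm : s t / s * t}}.
Proof.
by move=> s t _ _; apply/permP => x; rewrite permM !permE /base_act dK permM.
Qed.

Lemma fibre_permM : {in setT &, {morph fibre_perm : f g / f * g}}.
Proof.
move=> f g _ _; apply/permP => x.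
by rewrite permM !permE /fibre_act dK /= mulg_ffun permM.
Qed.

Canonical base_perm_morphism := Morphism base_permM.
Canonical fibre_perm_morphism := Morphism fibre_permM.

Lemma fibre_of_base_perm s x : fibre_of (base_perm s x) = s (fibre_of x).
Proof. by rewrite permE /fibre_of dK. Qed.

(** The witness [v] makes the fibres non-empty; with empty fibres every [s]
    would lift to the permutation of an empty set. *)
Lemma injm_base_perm (v : V) : 'injm base_perm_morphism.
Proof.
apply/injmP => s t _ _ /= st; apply/permP => u.
have fdu : fibre_of (d (u, v)) = u by rewrite /fibre_of dK.
by rewrite -fdu -2!fibre_of_base_perm st.
Qed.

Lemma injm_fibre_perm : 'injm fibre_perm_morphism.
Proof.
apply/injmP => f g _ _ /= /permP fg; apply/ffunP => u; apply/permP => v.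
have := fg (d (u, v)); rewrite !permE /fibre_act dK /=.
by move/(can_inj dK) => [].
Qed.

(** As an injective image of the direct product this group is isomorphic to it;
    [fibre_groupP] describes it as the kernel of the action on fibres, which is
    the form that makes it normal. *)
Definition fibre_group : {group {perm T}} := (fibre_perm_morphism @* setT)%G.

Lemma fibre_groupP (t : {perm T}) :
  reflect (forall x, fibre_of (t x) = fibre_of x) (t \in fibre_group).
Proof.
apply: (iffP idP) => [/morphimP[f _ _ ->] x | tP].
  by rewrite permE /fibre_of dK.
have t_inj u : injective (fun v => (e (t (d (u, v)))).2).
  move=> v w /= vw; suff /(can_inj dK) [] : d (u, v) = d (u, w) by [].
  apply: (@perm_inj _ t); apply: (can_inj eK).
  have tu z : (e (t (d (u, z)))).1 = u.
    by have := tP (d (u, z)); rewrite /fibre_of dK.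
  by rewrite [LHS]surjective_pairing [RHS]surjective_pairing !tu vw.
apply/morphimP; exists [ffun u => perm (@t_inj u)]; rewrite ?inE //.
apply/permP => x; rewrite permE /fibre_act ffunE permE -surjective_pairing eK.
by rewrite -[(e x).1]/(fibre_of x) -tP -surjective_pairing eK.
Qed.

Lemma isog_fibre_group : fibre_group \isog [set: {dffun U -> {perm V}}].
Proof. by rewrite isog_sym sub_isog ?injm_fibre_perm. Qed.

Lemma isog_base_perm (v : V) (H : {group {perm U}}) :
  base_perm_morphism @* H \isog H.
Proof. by rewrite isog_sym sub_isog ?subsetT ?injm_base_perm. Qed.

Lemma base_perm_norm_fibre_group (H : {group {perm U}}) :
  base_perm_morphism @* H \subset 'N(fibre_group).
Proof.
apply/subsetP => _ /morphimP[s _ _ ->]; rewrite inE.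
apply/subsetP => _ /imsetP[t /fibre_groupP tP ->]; apply/fibre_groupP => x.
by rewrite conjgE !permM fibre_of_base_perm tP -fibre_of_base_perm permKV.
Qed.

Lemma base_perm_TI_fibre_group (v : V) (H : {group {perm U}}) :
  fibre_group :&: base_perm_morphism @* H = 1.
Proof.
apply/trivgP/subsetP => t /setIP[/fibre_groupP tP /morphimP[s _ _ def_t]].
suff s1 : s = 1 by rewrite def_t s1 morph1 inE.
apply/permP => u; have := tP (d (u, v)).
by rewrite def_t fibre_of_base_perm /fibre_of dK perm1.
Qed.

(** From right to left the hypothesis lets [t] act on the set of fibres, and
    from left to right it makes this action injective, hence a permutation. *)
Lemma induced_fibre_perm (v : V) (t : {perm T}) :
    (forall x y, (fibre_of (t x) == fibre_of (t y))
                   = (fibre_of x == fibre_of y)) ->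
  {s : {perm U} | forall x, fibre_of (t x) = s (fibre_of x)}.
Proof.
move=> tP; have s_inj : injective (fun u => fibre_of (t (d (u, v)))).
  by move=> u w /= /eqP; rewrite tP /fibre_of !dK => /eqP.
exists (perm s_inj) => x; rewrite permE; apply/eqP.
by rewrite tP /fibre_of dK.
Qed.

End FibrePermutations.

(** * Automorphisms of a code with repeated coordinates *)

Section Inflation.

Import GRing.Theory.
Local Open Scope ring_scope.

Lemma perm_wordE N (t : 'S_N) (c : 'rV['F_2]_N) j :
  perm_word t c 0 j = c 0 (t^-1%g j).
Proof. by rewrite mxE. Qed.

Lemma Aut_codeP N (C : {vspace 'rV['F_2]_N}) (t : 'S_N) :
  reflect (forall c, c \in C -> perm_word t c \in C) (t \in Aut_code C).
Proof. by rewrite inE; exact: 'forall_implyP. Qed.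

Variables (N K L : nat) (e : 'I_N -> 'I_K * 'I_L) (d : 'I_K * 'I_L -> 'I_N).
Hypotheses (eK : cancel e d) (dK : cancel d e).
Variable v0 : 'I_L.
Variable C : {vspace 'rV['F_2]_K}.
Hypothesis C_sep : forall a b, (forall c, c \in C -> c 0 a = c 0 b) -> a = b.

Let p : 'I_N -> 'I_K := fibre_of e.

Definition inflation : {vspace 'rV['F_2]_N} :=
  (linfun (colsub p : 'rV['F_2]_K -> 'rV['F_2]_N) @: C)%VS.

Lemma mem_inflation c : c \in C -> colsub p c \in inflation.
Proof.
by move=> cC; apply/memv_imgP; exists c; rewrite ?lfunE.
Qed.

Lemma inflationP (c' : 'rV['F_2]_N) :
  reflect (exists2 c, c \in C & c' = colsub p c) (c' \in inflation).
Proof.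
by apply: (iffP memv_imgP) => -[c cC ->]; exists c; rewrite ?lfunE.
Qed.

Lemma colsub_fibre_inj : injective (colsub p : 'rV['F_2]_K -> 'rV['F_2]_N).
Proof.
move=> c c' /rowP cc'; apply/rowP => a.
by have := cc' (d (a, v0)); rewrite !mxE /p /fibre_of dK.
Qed.

(** This recovers the fibres from the code alone, which is why automorphisms
    of the inflated code cannot break them. *)
Lemma fibre_separation j k :
  reflect (forall c, c \in inflation -> c 0 j = c 0 k) (p j == p k).
Proof.
apply: (iffP eqP) => [pjk _ /inflationP[c _ ->] | sep].
  by rewrite !mxE pjk.
by apply: C_sep => c /mem_inflation/sep; rewrite !mxE.
Qed.

(** [colsub p] intertwines the action of a permutation with that of any
    permutation that it induces on the fibres. *)
Lemma perm_word_colsub (t : 'S_N) (s : 'S_K) c :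
    (forall j, p (t j) = s (p j)) ->
  perm_word t (colsub p c) = colsub p (perm_word s c).
Proof.
move=> ts; apply/rowP => j; rewrite perm_wordE !mxE; congr (c _ _).
by apply: (@perm_inj _ s); rewrite -ts !permKV.
Qed.

(** For [u] in the automorphism group, comparing the images of [c] under [u] at
    [u i] and [u i'] compares [c] at [i] and [i'].  Taking [u := t] and
    [u := t^-1] gives the two directions. *)
Lemma Aut_inflation_fibre t j k :
  t \in Aut_code inflation -> (p (t j) == p (t k)) = (p j == p k).
Proof.
have half u i i' :
    u \in Aut_code inflation -> p (u i) == p (u i') -> p i == p i'.
  move=> /Aut_codeP uA /fibre_separation sep; apply/fibre_separation => c cC.
  by have := sep _ (uA _ cC); rewrite !perm_wordE !permK.
move=> tA; apply/idP/idP; first exact: half.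
by move=> pjk; apply: (half t^-1%g); rewrite ?groupV // !permK.
Qed.

(** Let [t] be an automorphism inducing [s] on the fibres.  The lift of [s] has
    the same action on fibres as [t], so their quotient lies in the normal
    factor; and [s] is an automorphism of [C] because repetition of coordinates
    is injective and carries the action of [s] to that of [t]. *)
Lemma Aut_code_inflation :
  (fibre_group eK dK ><| (base_perm_morphism eK dK @* Aut_code C))%g
    = Aut_code inflation.
Proof.
rewrite sdprodE ?base_perm_norm_fibre_group //; last first.
  exact: base_perm_TI_fibre_group v0 _.
have fibreA : (fibre_group eK dK \subset Aut_code inflation)%g.
  apply/subsetP => t /fibre_groupP tP.
  apply/Aut_codeP => _ /inflationP[c cC ->].
  (* [t] induces the identity on the fibres, hence fixes every word. *)
  rewrite (@perm_word_colsub _ 1%g) => [|j]; last by rewrite perm1 /p tP.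
  by rewrite /perm_word invg1 col_perm1 mem_inflation.
have baseA :
    (base_perm_morphism eK dK @* Aut_code C \subset Aut_code inflation)%g.
  apply/subsetP => _ /morphimP[s _ /Aut_codeP sC ->].
  apply/Aut_codeP => _ /inflationP[c cC ->].
  rewrite (@perm_word_colsub _ s) => [|j]; last exact: fibre_of_base_perm.
  exact/mem_inflation/sC.
apply/eqP; rewrite eqEsubset mul_subG //=; apply/subsetP => t tA.
have [s ts] := induced_fibre_perm dK v0 (fun j k => Aut_inflation_fibre j k tA).
apply/mulsgP; exists (t * (base_perm eK dK s)^-1)%g (base_perm eK dK s).
- apply/fibre_groupP => j; rewrite permM; apply: (@perm_inj _ s).
  by rewrite -(fibre_of_base_perm eK dK) permKV ts.
- apply: mem_morphim; rewrite ?inE //=; apply/'forall_implyP => c cC.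
  have /inflationP[c' c'C] := Aut_codeP _ _ tA _ (mem_inflation cC).
  by rewrite (perm_word_colsub _ ts) => /colsub_fibre_inj ->.
- by rewrite mulgKV.
Qed.

End Inflation.

(** * Monomial codes *)

Section MonomialCodes.

Import GRing.Theory.
Local Open Scope ring_scope.

Lemma monomial_code_colsub n K N (p : 'I_N -> 'I_K) (x : 'I_n -> 'rV['F_2]_K)
    (M : {set monomial n}) :
  monomial_code (fun i => colsub p (x i)) M
    = (linfun (colsub p : 'rV['F_2]_K -> 'rV['F_2]_N) @: monomial_code x M)%VS.
Proof.
rewrite /monomial_code limg_span -map_comp; congr <<_>>%VS.
apply: eq_map => f; rewrite /= lfunE; apply/rowP => j; rewrite !mxE.
by apply: eq_bigr => i _; rewrite mxE.
Qed.

Lemma mem_monomial_code_var n N (x : 'I_n -> 'rV['F_2]_N) (M : {set monomial n})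
    i : [set i] \in M -> x i \in monomial_code x M.
Proof.
move=> iM; have -> : x i = monomial_eval x [set i].
  by apply/rowP => j; rewrite mxE big_set1.
by apply/memv_span/map_f; rewrite mem_enum.
Qed.

Lemma eq_binary_digits m a b : (a < 2 ^ m)%N -> (b < 2 ^ m)%N ->
  (forall i, (i < m)%N -> odd (a %/ 2 ^ i) = odd (b %/ 2 ^ i)) -> a = b.
Proof.
elim: m a b => [|m IHm] a b.
  by rewrite expn0 !ltnS !leqn0 => /eqP-> /eqP->.
rewrite expnSr => lta ltb ab.
rewrite -[a]odd_double_half -[b]odd_double_half.
have /= := ab 0%N isT; rewrite !divn1 => ->; congr (_ + _.*2)%N.
apply: IHm => [||i ltim]; rewrite -!divn2 ?ltn_divLR //.
by have := ab i.+1 ltim; rewrite expnS !divnMA.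
Qed.

Lemma eval_var_separates m (a b : 'I_(2 ^ m)) :
  (forall i : 'I_m, eval_var i 0 a = eval_var i 0 b) -> a = b.
Proof.
move=> ab; apply/val_inj/(eq_binary_digits (ltn_ord a) (ltn_ord b)) => i ltim.
by have := ab (Ordinal ltim); rewrite !mxE /=; do 2!case: odd.
Qed.

End MonomialCodes.

(** * Repetition of a word: positions as quotient and remainder *)

Section QuotientRemainder.

Variables m n : nat.
Hypothesis lemn : m <= n.

Lemma quotient_bound (j : 'I_(2 ^ n)) : j %/ 2 ^ m < 2 ^ (n - m).
Proof. by rewrite ltn_divLR ?expn_gt0 // -expnD subnK. Qed.

Lemma position_bound (ab : 'I_(2 ^ m) * 'I_(2 ^ (n - m))) :
  ab.2 * 2 ^ m + ab.1 < 2 ^ n.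
Proof.
case: ab => a b /=.
have -> : 2 ^ n = 2 ^ (n - m) * 2 ^ m by rewrite -expnD subnK.
apply: (@leq_trans (b.+1 * 2 ^ m)); last by rewrite leq_pmul2r ?expn_gt0.
by rewrite mulSnr ltn_add2l.
Qed.

Definition split_position (j : 'I_(2 ^ n)) : 'I_(2 ^ m) * 'I_(2 ^ (n - m)) :=
  (Ordinal (ltn_pmod j (expn_gt0 2 m)), Ordinal (quotient_bound j)).

Definition join_position ab : 'I_(2 ^ n) := Ordinal (position_bound ab).

Lemma split_positionK : cancel split_position join_position.
Proof. by move=> j; apply: val_inj; rewrite /= -divn_eq. Qed.

Lemma join_positionK : cancel join_position split_position.
Proof.
case=> a b; congr pair; apply: val_inj => /=.
  by rewrite modnMDl modn_small.
by rewrite divnMDl ?expn_gt0 // divn_small ?addn0.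
Qed.

Lemma concat_copies_colsub (c : 'rV['F_2%R]_(2 ^ m)) :
  concat_copies n c = colsub (fibre_of split_position) c.
Proof. by apply/rowP => j; rewrite !mxE. Qed.

End QuotientRemainder.

Theorem theorem3p1 (m n : nat) (S : {set monomial m})
    (Pm : {vspace 'rV['F_2]_(2 ^ m)}) (Pn : {vspace 'rV['F_2]_(2 ^ n)}) :
  (1 <= m)%N -> (m < n)%N ->
  (forall f : monomial m, f \in S -> (1 < #|f|)%N) ->
  polar_code (generating_set S) Pm ->
  Pn = monomial_code (fun i : 'I_m => concat_copies n (eval_var i))
                     (generating_set S) ->
  exists A G : {group 'S_(2 ^ n)},
    [/\ (A ><| G)%g = Aut_code Pn,
        (A \isog [set: {dffun 'I_(2 ^ m) -> 'S_(2 ^ (n - m))}])%g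
      & (G \isog Aut_code Pm)%g].
Proof.
move=> _ /ltnW lemn _ [_ PmE _] PnE.
pose eK := split_positionK lemn; pose dK := join_positionK lemn.
pose v0 : 'I_(2 ^ (n - m)) := Ordinal (expn_gt0 2 (n - m)).
have Pm_sep a b : (forall c, c \in Pm -> c ord0 a = c ord0 b) -> a = b.
  move=> ab; apply: eval_var_separates => i; apply: ab; rewrite PmE.
  by apply: mem_monomial_code_var; rewrite !inE imset_f ?orbT.
have -> : Pn = inflation (split_position lemn) Pm.
  rewrite PnE PmE /inflation -monomial_code_colsub /monomial_code.
  congr <<_>>%VS.
  apply: eq_map => f; apply/rowP => j; rewrite !mxE.
  by apply: eq_bigr => i _; rewrite -concat_copies_colsub.
exists (fibre_group eK dK), (base_perm_morphism eK dK @* Aut_code Pm)%G.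
split; first exact: (Aut_code_inflation eK dK v0 Pm_sep).
  exact: isog_fibre_group.
exact: isog_base_perm.
Qed.
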